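(* Let $n\ge 3$ and let $C\subseteq \mathrm{Sym}_{n-1}$ be a code with minimum distance $3$ in the Star graph $S_{n-1}$. Regard $\mathrm{Sym}_{n-1}$ as the subgroup of $\mathrm{Sym}_n$ fixing $n$. Then the set $$C^n=C\cup\bigcup_{2\le i\le n-1}(i\ n)C\subseteq \mathrm{Sym}_n$$ is a code in the Star graph $S_n$ of size $|C|(n-1)$ with minimum distance $3$.
   Context: $\mathrm{Sym}_n$ is the symmetric group on $\{1,\ldots,n\}$. For a group $G$ with an inverse-closed generating set $H$ not containing the identity, the Cayley graph $\Gamma(G,H)$ has vertex set $G$ and edge set $\{(hg,g): g\in G,\ h\in H\}$. The Star graph is $S_n=\Gamma(\mathrm{Sym}_n,\{(1\ i):2\le i\le n\})$. A code in a graph is a subset $C$ of its vertices; its size is $|C|$ and its minimum distance is $\min_{x,y\in C,\,x\ne y}d(x,y)$, where $d$ is the graph distance. For a permutation $\sigma$ and a set $C$ of permutations, $\sigma C=\{\sigma\pi:\pi\in C\}$. *)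

(* Defs.v *)
From mathcomp Require Import all_boot all_fingroup.

Set Implicit Arguments.
Unset Strict Implicit.
Unset Printing Implicit Defensive.

Local Open Scope group_scope.

Section Distance.

Variables (T : finType) (e : rel T).
Implicit Types (x y : T) (C : {set T}) (d : nat).

Definition walk k x y : bool :=
  [exists p : k.-tuple T, path e x p && (last x p == y)].

(* A shortest path has fewer than #|T| edges, so the search bound loses
   nothing; vertices in different components get the dummy value #|T|. *)
Definition gdist x y : nat := find (fun k => walk k x y) (iota 0 #|T|).

(* The minimum is attained, so a code with a minimum distance has at least two
   elements. *)
Definition has_min_distance C d : Prop :=
  (exists x y, [/\ x \in C, y \in C, x != y & gdist x y = d]) /\
  (forall x y, x \in C -> y \in C -> x != y -> d <= gdist x y).

End Distance.

Definition cayley (gT : finGroupType) (H : {set gT}) : rel gT :=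
  fun x y => [exists h in H, x == h * y].

(* The points 1, ..., n are represented by 0, ..., n - 1 in 'I_n.  The product
   of 'S_n applies its left factor first; inversion fixes transpositions and
   exchanges this convention with the opposite one. *)
Definition star_gens n : {set 'S_n} :=
  [set tperm i j | i in [set i : 'I_n | i == 0 :> nat],
                   j in [set j : 'I_n | 0 < j]].

Definition star n : rel 'S_n := cayley (star_gens n).

(* Extension of a permutation by the new last point as a fixed point. *)
Definition sym_incl n (s : 'S_n) : 'S_n.+1 := lift_perm ord_max ord_max s.

Definition extend_code n (C : {set 'S_n}) : {set 'S_n.+1} :=
  (@sym_incl n @: C) :|:
  \bigcup_(i : 'I_n.+1 | 0 < i < n) (tperm i ord_max *: (@sym_incl n @: C)).

(* Main.v *)
(* Write N for the new point, 0 for the centre of the star and t_i = (i N), so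
   that the new code is the union of the t_i C for i <> 0, with t_N = 1.  If
   t_i c and t_j d are at distance at most 2, then s = t_i (c d^-1) t_j is a
   product of at most two star transpositions.  If i = j, so is its conjugate
   c d^-1, because t_i fixes 0.  Otherwise s maps i to j, which forces
   s = (0 i)(0 j), and then c d^-1 = (0 i')(0 j') where k' is the image of k
   under (0 N).  In either case c and d are at distance at most 2 in the old
   graph, so c = d and finally i = j. *)

Require Import Defs.
From mathcomp Require Import all_boot all_fingroup.

Set Implicit Arguments.
Unset Strict Implicit.
Unset Printing Implicit Defensive.

Local Open Scope group_scope.

Lemma walk0 (T : finType) (e : rel T) x y : walk e 0 x y = (x == y).
Proof.
apply/existsP/idP => [[p]|xy]; first by rewrite tuple0.
by exists [tuple].
Qed.

Lemma walkS (T : finType) (e : rel T) k x y :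
  reflect (exists2 z, e x z & walk e k z y) (walk e k.+1 x y).
Proof.
apply: (iffP existsP) => [[p]|[z exz /existsP[p]]].
  case/tupleP: p => z p /= /andP[/andP[exz pz] lz].
  by exists z => //; apply/existsP; exists p; rewrite pz.
by move=> zp; exists [tuple of z :: p]; rewrite /= exz.
Qed.

Lemma gdist_le_walk (T : finType) (e : rel T) k x y :
  walk e k x y -> gdist e x y <= k.
Proof.
move=> wk; have [lek|ltk] := leqP #|T| k.
  by rewrite (leq_trans (find_size _ _)) ?size_iota.
rewrite leqNgt; apply/negP => /(before_find 0)/=.
by rewrite nth_iota // add0n wk.
Qed.

(** The strict bound excludes the dummy value [#|T|], so the search stopped at a realised length. *)
Lemma walk_gdist (T : finType) (e : rel T) x y :
  gdist e x y < #|T| -> walk e (gdist e x y) x y.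
Proof.
move=> lt; have: has (fun k => walk e k x y) (iota 0 #|T|).
  by rewrite has_find size_iota.
by move/(nth_find 0); rewrite nth_iota.
Qed.

Lemma starP n (x y : 'S_n.+1) :
  reflect (exists2 j : 'I_n.+1, j != ord0 & x = tperm ord0 j * y)
          (star x y).
Proof.
apply: (iffP existsP) => [[h /andP[/imset2P[i j]]]|[j j0 ->]].
  rewrite !inE => i0 j0 -> /eqP ->; exists j; first by rewrite -lt0n.
  by congr (tperm _ _ * _); apply/val_inj/eqP.
exists (tperm ord0 j); rewrite eqxx andbT.
by apply/imset2P; exists ord0 j; rewrite ?inE ?lt0n.
Qed.

(* [a = ord0] or [b = ord0] encode the shorter words. *)
Definition two_star n (s : 'S_n.+1) :=
  exists a b : 'I_n.+1, s = tperm ord0 a * tperm ord0 b.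

Lemma gdist_two_star n (x y : 'S_n.+1) :
  two_star (x * y^-1) -> gdist (@star n.+1) x y <= 2.
Proof.
case=> a [b /(canRL (mulgKV _)) ->].
(* Only a bound on the length is kept, since for [c = ord0] the factor is the identity and adds no
   edge. *)
have step (c : 'I_n.+1) k (u v : 'S_n.+1) : walk (@star n.+1) k u v ->
    exists2 k', k' <= k.+1 & walk (@star n.+1) k' (tperm ord0 c * u) v.
  have [->|c0] := eqVneq c ord0.
    by rewrite tperm1 mul1g; exists k.
  by move=> ?; exists k.+1 => //; apply/walkS; exists u => //; apply/starP; exists c.
have [|k1 le1 w1] := step b 0 y y; first by rewrite walk0.
have [k2 le2 w2] := step a k1 _ _ w1; rewrite -mulgA.
by rewrite (leq_trans (gdist_le_walk w2)) // (leq_trans le2).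
Qed.

(** The factorial is the number of vertices, so a distance of at most 2 is not the dummy value and
    comes from a walk. *)
Lemma two_star_gdist n (x y : 'S_n.+1) :
  2 < n.+1`! -> gdist (@star n.+1) x y <= 2 -> two_star (x * y^-1).
Proof.
move=> lt2 le2; have := @walk_gdist _ (@star n.+1) x y.
rewrite card_Sn (leq_ltn_trans le2) // => /(_ isT).
case: (gdist _ x y) le2 => [|[|[|//]]] _.
- by rewrite walk0 => /eqP->; exists ord0, ord0; rewrite mulgV tperm1 mulg1.
- case/walkS=> u /starP[j _ ->]; rewrite walk0 => /eqP->.
  by exists j, ord0; rewrite mulgK tperm1 mulg1.
- case/walkS=> u /starP[j _ ->] /walkS[v /starP[k _ ->]]; rewrite walk0 => /eqP->.
  by exists j, k; rewrite mulgA mulgK.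
Qed.

Lemma sym_inclM n : {morph @sym_incl n : s t / s * t}.
Proof. by move=> s t; rewrite /sym_incl lift_permM. Qed.

Lemma sym_inclV n (s : 'S_n) : sym_incl s^-1 = (sym_incl s)^-1.
Proof. by rewrite /sym_incl lift_permV. Qed.

Lemma sym_incl_max n (s : 'S_n) : sym_incl s ord_max = ord_max.
Proof. exact: lift_perm_id. Qed.

Lemma sym_incl_inj n : injective (@sym_incl n).
Proof.
move=> s t est; apply/permP => i; apply: (@lift_inj _ ord_max).
by rewrite -!(lift_perm_lift ord_max) -/(sym_incl _) est.
Qed.

Lemma sym_incl_tperm n (i j : 'I_n) :
  sym_incl (tperm i j) = tperm (lift ord_max i) (lift ord_max j).
Proof.
apply/permP => k; case: (unliftP ord_max k) => [k' ->|->].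
  by rewrite lift_perm_lift inj_tperm //; apply: lift_inj.
by rewrite sym_incl_max tpermD // eq_sym neq_lift.
Qed.

Lemma lift_max0 n : lift ord_max ord0 = ord0 :> 'I_n.+2.
Proof. exact/val_inj. Qed.

Lemma walk_sym_incl n k (x y : 'S_n.+1) :
  walk (@star n.+1) k x y -> walk (@star n.+2) k (sym_incl x) (sym_incl y).
Proof.
elim: k x => [|k IHk] x; first by rewrite !walk0 => /eqP->.
case/walkS=> z /starP[j j0 ->] /IHk wz; apply/walkS; exists (sym_incl z) => //.
apply/starP; exists (lift ord_max j); last by rewrite sym_inclM sym_incl_tperm lift_max0.
by rewrite -(lift_max0 n) (inj_eq lift_inj).
Qed.

(** A word of two letters fixing N uses [(0 N)] twice or not at all: either it cancels, or both
    letters already live in the smaller group. *)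
Lemma two_star_sym_incl n (s : 'S_n.+1) :
  two_star (sym_incl s) -> two_star s.
Proof.
case=> a [b es]; have max0 : ord_max != ord0 :> 'I_n.+2 by [].
have eab : (a == ord_max) = (b == ord_max).
  have := sym_incl_max s; rewrite es permM.
  have [->|aN] := eqVneq a ord_max.
    by rewrite tpermR tpermL => ->; rewrite eqxx.
  rewrite (tpermD _ aN) // => eb; apply/esym/negbTE/eqP => bN.
  by move: eb; rewrite bN tpermR => e0; rewrite -e0 eqxx in max0.
case: (unliftP ord_max a) => [a' ea|ea]; case: (unliftP ord_max b) => [b' eb|eb].
- exists a', b'; apply: sym_incl_inj.
  by rewrite sym_inclM !sym_incl_tperm lift_max0 -ea -eb.
- by move: eab; rewrite ea eb eqxx eq_sym (negbTE (neq_lift _ _)).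
- by move: eab; rewrite ea eb eqxx eq_sym (negbTE (neq_lift _ _)).
- exists ord0, ord0; apply: sym_incl_inj; rewrite es ea eb tperm2.
  by rewrite tperm1 mulg1 /sym_incl lift_perm1.
Qed.

Lemma two_starJ n (s : 'S_n.+1) (t : 'S_n.+1) :
  t ord0 = ord0 -> two_star s -> two_star (s ^ t).
Proof.
by move=> t0 [a [b ->]]; exists (t a), (t b); rewrite conjMg !tpermJ t0.
Qed.

(** The first letter must carry [i] to the centre: otherwise it fixes [i], and the second can only
    fix [i] or send it to 0, neither of which is [j]. *)
Lemma two_star_moves n (s : 'S_n.+1) i j :
  i != ord0 -> j != ord0 -> i != j -> s i = j -> two_star s ->
  s = tperm ord0 i * tperm ord0 j.
Proof.
move=> i0 j0 ij si [a [b es]]; move: si; rewrite es permM.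
have [-> | ai] := eqVneq a i; first by rewrite tpermR tpermL => ->.
rewrite (tpermD _ ai) 1?eq_sym //; case: tpermP => [e|_ e|_ _ e].
- by rewrite e eqxx in i0.
- by rewrite -e eqxx in j0.
- by rewrite e eqxx in ij.
Qed.

(* With [z = (0 N)], [(0 i) = z ^ t_i] where [t_i = (i N)], so that
   [t_i (0 i) (0 j) t_j = z t_i t_j z = (t_i ^ z) (t_j ^ z)]. *)
Lemma two_star_descent n (w : 'S_n.+1) (i j : 'I_n.+2) :
  i != ord0 -> j != ord0 ->
  two_star (tperm i ord_max * sym_incl w * tperm j ord_max) ->
  two_star w /\ (w = 1 -> i = j).
Proof.
set s := _ * _ * _ => i0 j0 ss.
have max0 : ord_max != ord0 :> 'I_n.+2 by [].
have fix0 k : k != ord0 -> tperm k ord_max ord0 = ord0 :> 'I_n.+2.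
  by move=> k0; rewrite tpermD.
have tK (u : 'S_n.+2) a b : u * tperm a b * tperm a b = u.
  by rewrite -mulgA tperm2 mulg1.
have ew : sym_incl w = tperm i ord_max * s * tperm j ord_max.
  by rewrite /s !mulgA tperm2 mul1g tK.
have [eij|ij] := eqVneq i j.
  split=> //; apply: two_star_sym_incl.
  have -> : sym_incl w = s ^ tperm j ord_max by rewrite conjgE tpermV mulgA ew eij.
  exact: two_starJ (fix0 _ j0) ss.
have si : s i = j by rewrite /s !permM tpermL sym_incl_max tpermR.
have es := two_star_moves i0 j0 ij si ss.
split=> [|w1].
  apply: two_star_sym_incl; rewrite ew es.
  have tJ (k : 'I_n.+2) : k != ord0 ->
      tperm ord0 k = tperm ord0 ord_max ^ tperm k ord_max.
    by move=> k0; rewrite tpermJ (fix0 _ k0) tpermR.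
  have zJ (k : 'I_n.+2) : tperm ord0 (tperm ord0 ord_max k) =
      tperm k ord_max ^ tperm ord0 ord_max.
    by rewrite tpermJ tpermR tpermC.
  exists (tperm ord0 ord_max i), (tperm ord0 ord_max j).
  by rewrite !zJ (tJ _ i0) (tJ _ j0) !conjgE !tpermV !mulgA tperm2 mul1g !tK.
(* For [w = 1], [s] is a product of two transpositions fixing 0, whereas [(0 i)(0 j)] sends 0 to
   [i]. *)
have s0 : s ord0 = ord0.
  by rewrite /s w1 /sym_incl lift_perm1 mulg1 permM !fix0.
have si0 : s ord0 = i by rewrite es permM tpermL tpermD // eq_sym.
by rewrite -si0 s0 eqxx in i0.
Qed.

(* The index [ord_max] contributes [C] itself, since [tperm x x = 1]. *)
Lemma extend_codeE n (C : {set 'S_n.+1}) :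
  extend_code C = [set tperm p.1 ord_max * sym_incl p.2 | p in setX [set~ ord0] C].
Proof.
apply/setP => x; apply/setUP/imsetP => [[/imsetP[c cC ->]|]|[[i c]]].
- by exists (ord_max, c); rewrite ?inE ?cC // tperm1 mul1g.
- case/bigcupP=> i /andP[i0 _] /lcosetP[_ /imsetP[c cC ->] ->].
  by exists (i, c); rewrite ?inE ?cC ?andbT // -lt0n.
rewrite !inE => /= /andP[i0 cC] ->; have [->|iN] := eqVneq i ord_max.
  by left; rewrite tperm1 mul1g imset_f.
right; apply/bigcupP; exists i; last by apply/lcosetP; exists (sym_incl c); rewrite ?imset_f.
by rewrite lt0n i0 ltn_neqAle -ltnS ltn_ord andbT.
Qed.

(** The index is recovered as the point that the product sends to N; the transposition then
    cancels. *)
Lemma extend_code_inj n (i j : 'I_n.+1) (c d : 'S_n) :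
  tperm i ord_max * sym_incl c = tperm j ord_max * sym_incl d -> i = j /\ c = d.
Proof.
move=> e; have eij : i = j.
  apply: (@perm_inj _ (tperm j ord_max * sym_incl d)).
  by rewrite -{1}e !permM !tpermL !sym_incl_max.
by split=> //; move: e; rewrite eij => /mulgI/sym_incl_inj.
Qed.

Theorem theorem3 (n : nat) (hn : 2 <= n) (C : {set 'S_n})
    (hC : has_min_distance (@star n) C 3) :
  #|extend_code C| = (#|C| * n)%N /\
  has_min_distance (@star n.+1) (extend_code C) 3.
Proof.
case: n hn C hC => [//|n] n_gt0 C [[x [y [xC yC xy dxy]]] dmin].
have fact3 : 2 < n.+2`! by rewrite (@leq_trans 3`!) // leq_fact.
have min3 u v : u \in extend_code C -> v \in extend_code C -> u != v ->
    3 <= gdist (@star n.+2) u v.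
  rewrite !extend_codeE => /imsetP[[i c] + ->] /imsetP[[j d] + ->] /=.
  rewrite !inE => /= /andP[i0 cC] /andP[j0 dC] uv.
  rewrite ltnNge; apply/negP => /(two_star_gdist fact3).
  (* This brings the quotient to the form [t_i w t_j] with [w = c * d^-1]. *)
  rewrite invMg tpermV !mulgA -(mulgA _ (sym_incl c)) -sym_inclV -sym_inclM.
  case/(two_star_descent i0 j0)=> cd eij.
  have [ecd|ncd] := eqVneq c d.
    by case/eqP: uv; rewrite eij ecd ?mulgV.
  by have := dmin _ _ cC dC ncd; rewrite ltnNge gdist_two_star.
split.
  rewrite extend_codeE card_in_imset ?cardsX ?cardsC1 ?card_ord 1?mulnC //.
  by move=> [i c] [j d] _ _ /= /extend_code_inj[-> ->].
split=> //; have mem c : c \in C -> sym_incl c \in extend_code C.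
  by move=> cC; rewrite inE imset_f.
have xy' : sym_incl x != sym_incl y by rewrite (inj_eq (@sym_incl_inj _)).
exists (sym_incl x), (sym_incl y); split; rewrite ?mem //.
(* The minimum is attained inside the copy of [C]: a walk of length 3 from [x] to [y] lifts to the
   larger graph. *)
apply/eqP; rewrite eqn_leq min3 ?mem // andbT.
apply: gdist_le_walk; apply: walk_sym_incl; rewrite -dxy; apply: walk_gdist.
have: gdist (@star n.+1) x y <= #|'S_n.+1|.
  by rewrite (leq_trans (find_size _ _)) ?size_iota.
rewrite dxy card_Sn; case: n {x y xC yC xy dxy dmin mem xy' C min3 fact3} n_gt0 => [|[|n]] // _ _.
by rewrite (@leq_trans 3`!) // leq_fact.
Qed.
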